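(* Let $n,k\ge 1$ be integers. The number of maximum rook placements on $B^{\circ}_{n,k}$ is: \begin{itemize} \item if $k$ is even: $$(n!)^{\frac{k}{2}}\sum_{j=0}^{n}\binom{n}{j}^{\frac{k}{2}};$$ \item if $k$ is odd and $n$ is even: $$\left((n)_{\frac{n}{2}}\right)^{k};$$ \item if $k$ is odd and $n$ is odd: $$k\left\lceil\tfrac{n}{2}\right\rceil\left((n)_{\lceil\frac{n}{2}\rceil}\right)^{\lfloor\frac{k}{2}\rfloor}\left((n)_{\lfloor\frac{n}{2}\rfloor}\right)^{\lceil\frac{k}{2}\rceil}.$$ \end{itemize}
   Context: The circular configuration $B^{\circ}_{n,k}$ is a $k$-tuple $(B^{(1)},\dots,B^{(k)})$ of $n\times n$ chessboards with rows and columns numbered $1,\dots,n$. Two rooks are attacking on $B^{\circ}_{n,k}$ if they are in the same row or the same column of the same board, or if one is in the $j$th row of $B^{(i-1)}$ and the other is in the $j$th column of $B^{(i)}$ for some $1\le j\le n$ and $1\le i\le k$, where $B^{(0)}$ is identified with $B^{(k)}$. For $k=1$, a rook in cell $(j,j)$ is considered to attack itself (it is both in row $j$ and in column $j$), so no rook of a non-attacking placement on $B^{\circ}_{n,1}$ lies on the main diagonal. A set of rooks (at most one per cell) is non-attacking if there is no attack among them. A maximum rook placement is a non-attacking placement whose number of rooks is the largest possible among all non-attacking placements on the board; a placement is determined by its set of occupied cells. $(n)_a=n(n-1)\cdots(n-a+1)$ is the falling factorial, with $(n)_0=1$. *)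

(* Defs.v *)
From mathcomp Require Import all_boot.

Set Implicit Arguments.
Unset Strict Implicit.
Unset Printing Implicit Defensive.

(* The cell in row [r] and column [c] of the board [b] is [(b, r, c)]; boards,
   rows and columns are numbered from 0. *)
Definition cell (n k : nat) : finType := ('I_k * 'I_n * 'I_n)%type.

Definition board n k (x : cell n k) : 'I_k := x.1.1.
Definition row n k (x : cell n k) : 'I_n := x.1.2.
Definition col n k (x : cell n k) : 'I_n := x.2.

Definition line_attack n k (x y : cell n k) : bool :=
  [&& x != y, board x == board y & (row x == row y) || (col x == col y)].

(* [ord_pred] is the cyclic predecessor on ['I_k].  Here [x = y] is allowed:
   this happens only for [k = 1], where a rook on the main diagonal attacks
   itself. *)
Definition circ_attack n k (x y : cell n k) : bool :=
  (board x == ord_pred (board y)) && (row x == col y).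

Definition attacking n k (x y : cell n k) : bool :=
  [|| line_attack x y, circ_attack x y | circ_attack y x].

Definition nonattacking n k (A : {set cell n k}) : bool :=
  [forall x in A, forall y in A, ~~ attacking x y].

Definition maximum_placement n k (A : {set cell n k}) : bool :=
  nonattacking A && [forall B : {set cell n k}, nonattacking B ==> (#|B| <= #|A|)].

(* Main.v *)
Require Import Defs.
From mathcomp Require Import all_boot zify.

Set Implicit Arguments.
Unset Strict Implicit.
Unset Printing Implicit Defensive.

(** Why the counts hold.  Let [R_i] and [C_i] be the sets of rows and of columns
occupied on board [i], so that [#|R_i| = #|C_i| = r_i].  A placement is
nonattacking exactly when every board carries a partial permutation matrix and
[C_i] avoids [R_{i-1}] (indices are cyclic).  Hence, once the row sets are
fixed, the boards can be filled independently: board [i] takes an injection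
from [R_i] to the [n - r_{i-1}] columns outside [R_{i-1}].  There are
['C(n, r_i)] row sets of size [r_i], so the number of nonattacking placements
with [r_i] rooks on board [i], for all [i], is the weight
[\prod_i 'C(n, r_i) * (n - r_{i-1}) ^_ r_i] ([card_nonattacking]).

A nonzero weight forces [r_{i-1} + r_i <= n].  Adding these inequalities around
the cycle gives [2 * \sum_i r_i <= n * k], so that no placement has more than
[(n * k)./2] rooks.  Call [n - (r_{i-1} + r_i)] the slack at [i]; for
placements with [(n * k)./2] rooks the slacks add up to the parity of [n * k]
([sum_slack_parity]).  This leaves very few size vectors [r], and summing
their weights gives the three formulas ([card_maximum_from_sizes]).

- [k] even: all slacks vanish, so [r] alternates between [j] and [n - j] for
  some [0 <= j <= n].
- [k] odd, [n] even: all slacks vanish, and going around an odd cycle forces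
  [r_i = n./2] for all [i].
- [k] and [n] odd: one board [i0] has slack 1 and the others 0.  For each of the
  [k] choices of [i0] the vector is unique, because the sums of adjacent entries
  determine a vector on an odd cycle: from [i0] onwards it reads
  [n./2, uphalf n, n./2, ..., n./2].

Where the slack vanishes, the factor of the weight is [n ^_ r_i]; at [i0] it is
[uphalf n] times larger, since the columns there are chosen among [uphalf n]
instead of [n./2] free ones. *)

(** * Rook placements on one board *)

Definition rook (S T : finType) (B : {set S * T}) : bool :=
  [forall x in B, forall y in B,
     (x.1 == y.1) || (x.2 == y.2) ==> (x == y)].

Definition rows (S T : finType) (B : {set S * T}) : {set S} := [set x.1 | x in B].
Definition cols (S T : finType) (B : {set S * T}) : {set T} := [set x.2 | x in B].

Lemma rookP (S T : finType) (B : {set S * T}) :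
  reflect ({in B &, injective fst} /\ {in B &, injective snd}) (rook B).
Proof.
apply: (iffP 'forall_in_'forall_in_implyP) => [H | [H1 H2] x xB y yB].
  by split=> x y xB yB E; apply/eqP/(H x xB y yB); rewrite E eqxx ?orbT.
by case/orP=> /eqP E; apply/eqP; [apply: H1 | apply: H2].
Qed.

Lemma card_rows (S T : finType) (B : {set S * T}) : rook B -> #|rows B| = #|B|.
Proof. by move=> /rookP[H _]; rewrite card_in_imset. Qed.

(** Such a placement is the graph of an injection from the subtype of [R] into
[D]; these injections are counted by a falling factorial. *)
Lemma card_rook_placements (S T : finType) (R : {set S}) (D : {set T}) :
  #|[set B : {set S * T} | [&& rook B, rows B == R & cols B \subset D]]|
    = #|D| ^_ #|R|.
Proof.
pose graph (f : {ffun {x | x \in R} -> T}) := [set (val x, f x) | x : {x | x \in R}].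
have graphE (f : {ffun {x | x \in R} -> T}) x :
    (val x, f x) \in graph f by apply: imset_f.
transitivity #|graph @: [set f in ffun_on (mem D) | injectiveb f]|; last first.
  rewrite card_in_imset ?card_inj_ffuns_on ?card_sig // => f g _ _ E.
  apply/ffunP=> x; have := graphE f x; rewrite E => /imsetP[y _ [/val_inj-> ->]].
  by [].
apply: eq_card => B; rewrite inE; apply/and3P/imsetP => [[]|[f]].
  move=> /rookP[H1 H2] /eqP RE /subsetP CD.
  have ex (x : {x | x \in R}) : exists c, (val x, c) \in B.
    case: x => x /=; rewrite -RE => /imsetP[[y c] yB /= ->]; by exists c.
  pose f := [ffun x => xchoose (ex x)].
  have fB x : (val x, f x) \in B by rewrite ffunE; apply: (xchooseP (ex x)).
  exists f.
    rewrite inE; apply/andP; split.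
      by apply/ffun_onP=> x; apply: CD; apply/imsetP; exists (val x, f x).
    apply/injectiveP=> x y E; apply: val_inj.
    by have [] := H2 _ _ (fB x) (fB y) E.
  apply/setP=> -[x c]; apply/idP/imsetP=> [xB|[y _ ->] //].
  have xR : x \in R by rewrite -RE; apply/imsetP; exists (x, c).
  by exists (exist _ x xR) => //; apply: H1 (fB (exist _ x xR)) _.
rewrite inE => /andP[/ffun_onP fD /injectiveP fi] ->; split.
- apply/rookP; split=> _ _ /imsetP[x _ ->] /imsetP[y _ ->] /=.
    by move=> /val_inj ->.
  by move=> /fi ->.
- apply/eqP/setP=> x; apply/imsetP/idP=> [[_ /imsetP[y _ ->] ->]|xR].
    exact: valP.
  by exists (x, f (exist _ x xR)) => //; apply: (graphE f (exist _ x xR)).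
- by apply/subsetP=> _ /imsetP[_ /imsetP[y _ ->] ->]; apply: fD.
Qed.

(** * Counting nonattacking placements by their row sets *)

Section Boards.
Variables n k : nat.
Implicit Types A : {set cell n k}.

Definition boards A : {ffun 'I_k -> {set 'I_n * 'I_n}} :=
  [ffun i => [set p | (i, p.1, p.2) \in A]].

Lemma boards_bij : bijective boards.
Proof.
exists (fun B : {ffun 'I_k -> {set 'I_n * 'I_n}} =>
          [set x : cell n k | (x.1.2, x.2) \in B x.1.1]).
  by move=> A; apply/setP=> -[[i r] c]; rewrite inE ffunE inE.
by move=> B; apply/ffunP=> i; rewrite ffunE; apply/setP=> -[r c]; rewrite !inE.
Qed.

(** This turns the pairwise attack relation into conditions of which only
[rows (boards A (ord_pred i))] involves a second board, so that the boards
decouple as soon as the row sets are prescribed. *)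
Lemma nonattackingE A : nonattacking A =
  [forall i, rook (boards A i)
             && (cols (boards A i) \subset ~: rows (boards A (ord_pred i)))].
Proof.
apply/idP/forallP=> [/'forall_in_'forall_in_idP H i|H].
  apply/andP; split.
    apply/rookP; split=> -[r c] [r' c']; rewrite ffunE !inE /= => H1 H2 E;
    have := H _ H1 _ H2; rewrite /attacking /line_attack /board /row /col /=;
    rewrite !xpair_eqE E !eqxx;
    by case: eqP => [->|_] //=; rewrite ?andbT ?orbT.
  apply/subsetP=> _ /imsetP[[r c] rB ->] /=; rewrite inE; apply/negP.
  move: rB; rewrite ffunE inE /= => rA /imsetP[[r' c']]; rewrite ffunE inE /= => rA' E.
  have := H _ rA' _ rA; rewrite /attacking /circ_attack /board /row /col /= E !eqxx.
  by rewrite !orbT.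
have circ x y : x \in A -> y \in A -> ~~ circ_attack x y.
  case: x y => [[i r] c] [[j r'] c'] xA yA; apply/negP => /andP[].
  rewrite /board /row /col /= => /eqP E /eqP E'; subst.
  have /andP[_ /subsetP/(_ c')] := H j.
  rewrite inE; case/(_ _)/negP.
    by apply/imsetP; exists (r', c'); rewrite // ffunE inE.
  by apply/imsetP; exists (c', c); rewrite // ffunE inE.
apply/'forall_in_'forall_in_idP => x xA y yA; rewrite /attacking !negb_or !circ // !andbT.
move: x y xA yA => [[i r] c] [[j r'] c'] xA yA.
rewrite /line_attack /board /row /col /=; apply/negP => /and3P[+ /eqP E]; subst.
have /andP[/rookP[H1 H2] _] := H j; rewrite !xpair_eqE eqxx /=.
have iB : (r, c) \in boards A j by rewrite ffunE inE.
have jB : (r', c') \in boards A j by rewrite ffunE inE.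
move=> N /orP[] /eqP E.
  by have [_ E'] := H1 _ _ iB jB E; rewrite E E' !eqxx in N.
by have [E' _] := H2 _ _ iB jB E; rewrite E E' !eqxx in N.
Qed.

Lemma card_boards A : #|A| = \sum_i #|boards A i|.
Proof.
rewrite -sum1_card (partition_big (@board n k) xpredT) //=; apply: eq_bigr => i _.
rewrite sum1dep_card.
have inj : injective (fun p : 'I_n * 'I_n => (i, p.1, p.2)) by move=> [a b] [c d] [-> ->].
rewrite -(card_imset _ inj); apply: eq_card => -[[j r] c]; rewrite !inE /board /=.
apply/andP/imsetP=> [[xA /eqP<-]|[[r' c']]].
  by exists (r, c); rewrite // ffunE inE.
by rewrite ffunE inE /= => xA [-> -> ->].
Qed.

Definition row_sets A : {ffun 'I_k -> {set 'I_n}} := [ffun i => rows (boards A i)].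

(** With all row sets prescribed, the placements form a product over the
boards. *)
Lemma card_nonattacking_row_sets (R : {ffun 'I_k -> {set 'I_n}}) :
  #|[set A : {set cell n k} | nonattacking A & row_sets A == R]|
    = \prod_i (n - #|R (ord_pred i)|) ^_ #|R i|.
Proof.
pose F i := [set B : {set 'I_n * 'I_n} |
  [&& rook B, rows B == R i & cols B \subset ~: R (ord_pred i)]].
have Fi i : #|F i| = (n - #|R (ord_pred i)|) ^_ #|R i|.
  by rewrite card_rook_placements cardsCs setCK card_ord.
under eq_bigr do rewrite -Fi.
have -> : \prod_i #|F i| = #|family (fun i => mem (F i))|.
  by rewrite card_family foldrE big_map big_enum.
have bb := boards_bij.
rewrite -(on_card_preimset (onW_bij _ bb)); apply: eq_card => A; rewrite !inE.
rewrite nonattackingE; apply/andP/familyP=> [[/forallP H /eqP E] i|H].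
  have RE j : R j = rows (boards A j) by rewrite -E ffunE.
  by have /andP[Hi Hc] := H i; rewrite inE Hi !RE eqxx.
have RE i : R i = rows (boards A i) by have := H i; rewrite inE => /and3P[_ /eqP].
split; last by apply/eqP/ffunP=> i; rewrite ffunE RE.
by apply/forallP=> i; have := H i; rewrite inE => /and3P[-> _]; rewrite RE.
Qed.

(** The number of nonattacking placements with [r i] rooks on board [i]. *)
Definition weight (r : {ffun 'I_k -> 'I_n.+1}) : nat :=
  \prod_i ('C(n, r i) * (n - r (ord_pred i)) ^_ (r i)).

(** Group the placements first by their row sets, then by the sizes of the row
sets: the product above depends only on the sizes, and [r i]-subsets of the rows
are counted by binomials. *)
Lemma card_nonattacking (m : nat) :
  #|[set A : {set cell n k} | nonattacking A & #|A| == m]|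
    = \sum_(r : {ffun 'I_k -> 'I_n.+1} | \sum_i r i == m) weight r.
Proof.
pose sizes (R : {ffun 'I_k -> {set 'I_n}}) : {ffun 'I_k -> 'I_n.+1} :=
  [ffun i => inord #|R i|].
have sizesE R i : sizes R i = #|R i| :> nat.
  by rewrite ffunE inordK // ltnS -[n in _ <= n]card_ord max_card.
have cardA A : nonattacking A -> #|A| = \sum_i sizes (row_sets A) i.
  rewrite nonattackingE card_boards => /forallP H; apply: eq_bigr => i _.
  by rewrite sizesE [row_sets A i]ffunE card_rows //; have /andP[] := H i.
rewrite -sum1dep_card (partition_big (fun A => sizes (row_sets A))
  (fun r : {ffun 'I_k -> 'I_n.+1} => \sum_i r i == m)) /=; last first.
  by move=> A /andP[/cardA <-].
apply: eq_bigr => r /eqP rm.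
transitivity (\sum_(R | sizes R == r) \sum_(A | nonattacking A && (row_sets A == R)) 1).
  rewrite (partition_big row_sets (fun R => sizes R == r)) /=; last by move=> A /andP[].
  apply: eq_bigr => R /eqP sR; apply: eq_bigl => A; apply/andP/andP.
    by case=> [/andP[/andP[-> _] _] ->].
  by case=> nA /eqP AR; rewrite AR nA sR !eqxx cardA // AR sR rm eqxx.
have cst R : sizes R == r ->
    \sum_(A | nonattacking A && (row_sets A == R)) 1
      = \prod_i (n - r (ord_pred i)) ^_ r i.
  move=> /eqP <-; rewrite sum1dep_card card_nonattacking_row_sets.
  by apply: eq_bigr => i _; rewrite !sizesE.
rewrite (eq_bigr _ cst) sum_nat_const /weight big_split; congr (_ * _).
transitivity #|family (fun i => [pred X : {set 'I_n} | #|X| == r i])|.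
  apply: eq_card => R; transitivity (sizes R == r); first by [].
  apply/eqP/familyP=> [<- i|H].
    by rewrite inE sizesE.
  by apply/ffunP=> i; apply: val_inj; rewrite /= sizesE; apply/eqP; have := H i.
rewrite card_family foldrE big_map big_enum /=; apply: eq_bigr => i _.
by rewrite -[n in 'C(n, _)]card_ord -card_draws cardsE.
Qed.

(** * Size vectors of maximum placements *)

Lemma weight_gt0 r : 0 < weight r -> forall i, r (ord_pred i) + r i <= n.
Proof.
move=> + i; rewrite /weight (bigD1 i) //= !muln_gt0 ffact_gt0.
case/andP => /andP[_ ri] _; have := leq_ord (r (ord_pred i)); lia.
Qed.

Lemma sum_adjacent (r : 'I_k -> nat) :
  \sum_i (r (ord_pred i) + r i) = (\sum_i r i).*2.
Proof.
rewrite big_split /= -addnn; congr (_ + _).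
by rewrite [RHS](reindex (@ord_pred k)) //; apply/onW_bij/ord_pred_bij.
Qed.

(** Each entry of [r] occurs in exactly two of the adjacent sums. *)
Lemma double_sum_slack (r b : 'I_k -> nat) :
  (forall i, r (ord_pred i) + r i + b i = n) ->
  (\sum_i r i).*2 + \sum_i b i = n * k.
Proof.
move=> H; rewrite -sum_adjacent -big_split /= (eq_bigr (fun=> n)) //.
by rewrite sum_nat_const card_ord mulnC.
Qed.

(** The size vector of [A] has nonzero weight, hence nonnegative slacks. *)
Lemma nonattacking_leq A : nonattacking A -> #|A| <= (n * k)./2.
Proof.
move=> nA.
have : 0 < #|[set A' : {set cell n k} | nonattacking A' & #|A'| == #|A|]|.
  by rewrite card_gt0; apply/set0Pn; exists A; rewrite inE nA eqxx.
rewrite card_nonattacking lt0n sum_nat_eq0 negb_forall => /existsP[r].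
rewrite negb_imply -lt0n => /andP[/eqP <- /weight_gt0 H].
have /= := @double_sum_slack (fun i => r i : nat)
  (fun i => n - (r (ord_pred i) + r i)) (fun i => subnKC (H i)).
lia.
Qed.

(** It suffices to list, without repetition, all size vectors of positive weight
and total [(n * k)./2]: as soon as one exists, the bound of [nonattacking_leq] is
attained, and the maximum placements are those of that size. *)
Lemma card_maximum_from_sizes (I : finType) (f : I -> {ffun 'I_k -> 'I_n.+1}) (j : I) :
    injective f ->
    (forall x, \sum_i f x i = (n * k)./2) ->
    (forall r : {ffun 'I_k -> 'I_n.+1}, 0 < weight r ->
      \sum_i r i = (n * k)./2 -> exists x, r = f x) ->
    0 < weight (f j) ->
  #|[set A : {set cell n k} | maximum_placement A]| = \sum_x weight (f x).
Proof.
move=> f_inj f_sum f_all fj.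
transitivity (\sum_(r : {ffun 'I_k -> 'I_n.+1} | \sum_i r i == (n * k)./2) weight r).
  have E := card_nonattacking (n * k)./2.
  have [A0] :
    exists A, A \in [set A : {set cell n k} | nonattacking A & #|A| == (n * k)./2].
    by apply/set0Pn; rewrite -card_gt0 E (bigD1 (f j)) ?f_sum //= addn_gt0 fj.
  rewrite inE => /andP[nA0 /eqP cA0].
  rewrite -E; apply: eq_card => A; rewrite !inE /maximum_placement.
  case nA: (nonattacking A) => //=.
  apply/forallP/eqP => [/(_ A0)|-> B]; last by apply/implyP=> /nonattacking_leq.
  by rewrite nA0 cA0 /= => le; apply/eqP; rewrite eqn_leq le nonattacking_leq.
rewrite -(big_imset weight (A := predT) (in2W f_inj)) /=.
rewrite [LHS]big_mkcond [RHS]big_mkcond /=; apply: eq_bigr => r _.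
case: (posnP (weight r)) => [->|r_gt0]; first by rewrite !if_same.
congr (if _ then _ else _); apply/eqP/imsetP => [/(f_all _ r_gt0)[x ->]|[x _ ->]] //.
by exists x.
Qed.

Lemma sum_slack_parity (r : {ffun 'I_k -> 'I_n.+1}) :
    0 < weight r -> \sum_i r i = (n * k)./2 ->
  \sum_i (n - (r (ord_pred i) + r i)) = odd (n * k).
Proof.
move=> /weight_gt0 H rM.
have /= := @double_sum_slack (fun i => r i : nat)
  (fun i => n - (r (ord_pred i) + r i)) (fun i => subnKC (H i)).
rewrite rM; lia.
Qed.

(** With [a] rows used on the previous board and zero slack, the [b] rooks must
fill all free columns, so that only the row set and a permutation are free. *)
Lemma tight_factor a b : a + b = n -> 'C(n, b) * (n - a) ^_ b = n ^_ b.
Proof. by move=> <-; rewrite addKn ffactnn bin_ffact. Qed.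

End Boards.

(** * Vectors on a cycle with prescribed adjacent sums *)

Lemma val_ord_pred k (i : 'I_k) :
  ord_pred i = (if i == 0 :> nat then k.-1 else i.-1) :> nat.
Proof.
case: k i => [[]//|k] i /=; case: eqP => [->|]; first by rewrite add0n modn_small.
move=> i0; have ik := ltn_ord i.
have -> : (i + k.+1).-1 = i.-1 + k.+1 by lia.
by rewrite modnDr modn_small //; lia.
Qed.

(** The difference of two vectors with the same adjacent sums changes sign from
one index to the next; the two cases state this without subtraction. *)
Lemma adjacent_sums_alternate k (r r' : 'I_k.+1 -> nat) :
    (forall i, r (ord_pred i) + r i = r' (ord_pred i) + r' i) ->
  forall i : 'I_k.+1, if odd i then r i + r ord0 = r' i + r' ord0
            else r i + r' ord0 = r' i + r ord0.
Proof.
move=> H i; rewrite -(inord_val i); have := ltn_ord i.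
elim: (i : nat) => [|m IH] mk.
  by rewrite inordK // (_ : inord 0 = ord0) 1?addnC //; apply: val_inj; rewrite /= inordK.
have pE : ord_pred (inord m.+1 : 'I_k.+1) = inord m.
  by apply: ord_inj; rewrite val_ord_pred /= !inordK //; lia.
have := H (inord m.+1); rewrite pE; have := IH (ltnW mk).
rewrite !inordK //=; last lia.
by case: (odd m) => /=; lia.
Qed.

Lemma adjacent_sums_inj k (r r' : 'I_k.+1 -> nat) :
    (forall i, r (ord_pred i) + r i = r' (ord_pred i) + r' i) ->
  r ord0 = r' ord0 -> r =1 r'.
Proof. by move=> /adjacent_sums_alternate H E i; have := H i; case: odd; lia. Qed.

(** Around an odd cycle, the alternating difference returns to its starting
point with the opposite sign, hence vanishes. *)
Lemma adjacent_sums_odd_inj k (r r' : 'I_k.+1 -> nat) : odd k.+1 ->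
    (forall i, r (ord_pred i) + r i = r' (ord_pred i) + r' i) ->
  r =1 r'.
Proof.
move=> ok H; apply: adjacent_sums_inj => //.
have := H ord0; have := adjacent_sums_alternate H (ord_pred ord0).
by rewrite val_ord_pred /= ifN //; lia.
Qed.

(** * The three cases *)

Lemma prod_parity k X Y :
  \prod_(i < k) (if odd i then X else Y) = X ^ k./2 * Y ^ uphalf k.
Proof.
elim: k => [|k IH]; first by rewrite big_ord0.
rewrite big_ord_recr /= IH uphalf_half.
by case: (odd k) => /=; rewrite ?add0n ?add1n ?expnSr; lia.
Qed.

(** The size vectors are [j, n - j, j, n - j, ...]; they have weight
[(n ^_ j * n ^_ (n - j)) ^ k.+1./2], and [n ^_ j * n ^_ (n - j) = n`! * 'C(n, j)]. *)
Lemma card_maximum_even n k : ~~ odd k.+1 ->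
  #|[set A : {set cell n k.+1} | maximum_placement A]| =
    n`! ^ k.+1./2 * \sum_(0 <= j < n.+1) 'C(n, j) ^ k.+1./2.
Proof.
move=> ek.
pose f (j : 'I_n.+1) : {ffun 'I_k.+1 -> 'I_n.+1} :=
  [ffun i : 'I_k.+1 => if odd i then rev_ord j else j].
have adj j i : f j (ord_pred i) + f j i = n.
  have jn := leq_ord j; rewrite !ffunE val_ord_pred.
  case: eqP => [->|/eqP i0] /=; first by rewrite (negbNE ek : odd k) /=; lia.
  have -> : odd i.-1 = ~~ odd i by lia.
  by case: odd => /=; lia.
have fw j : weight (f j) = (n ^_ (n - j)) ^ k.+1./2 * (n ^_ j) ^ k.+1./2.
  transitivity (\prod_(i < k.+1) (if odd i then n ^_ (n - j) else n ^_ j)).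
    apply: eq_bigr => i _; rewrite tight_factor // ffunE.
    by case: odd => //=; rewrite subSS.
  by rewrite prod_parity; congr (_ * _ ^ _); lia.
rewrite (@card_maximum_from_sizes _ _ _ f ord0).
- rewrite big_mkord big_distrr /=; apply: eq_bigr => j _.
  rewrite fw -!expnMn; congr (_ ^ _).
  have jn := leq_ord j.
  rewrite -(bin_ffact n j) mulnCA mulnC; congr (_ * _).
  by have := ffact_fact (leq_subr j n); rewrite subKn.
- by move=> x y /ffunP/(_ ord0); rewrite !ffunE.
- move=> j; have /= := @double_sum_slack n k.+1 (fun i => f j i : nat) (fun=> 0)
    (fun i => etrans (addn0 _) (adj j i)).
  by rewrite big1_eq; lia.
- move=> r r_gt0 rM; exists (r ord0).
  have := sum_slack_parity r_gt0 rM; rewrite oddM (negbTE ek) andbF => /eqP.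
  rewrite sum_nat_eq0 => /forallP sl0.
  apply/ffunP=> i; apply: val_inj => /=.
  apply: (@adjacent_sums_inj _ (fun i => r i : nat)
    (fun i => f (r ord0) i : nat)) => [{}i|].
    have := sl0 i; have := weight_gt0 r_gt0 i; rewrite adj; lia.
  by rewrite ffunE.
- by rewrite fw muln_gt0 !expn_gt0 !ffact_gt0 leq_subr.
Qed.

(** The constant vector [n./2] has zero slack, and is the only such vector. *)
Lemma card_maximum_odd_even n k : odd k.+1 -> ~~ odd n ->
  #|[set A : {set cell n k.+1} | maximum_placement A]| = (n ^_ n./2) ^ k.+1.
Proof.
move=> ok en.
have hn : n./2 < n.+1 by lia.
pose r0 : {ffun 'I_k.+1 -> 'I_n.+1} := [ffun=> Ordinal hn].
have adj i : r0 (ord_pred i) + r0 i = n by rewrite !ffunE /=; lia.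
have wr0 : weight r0 = (n ^_ n./2) ^ k.+1.
  rewrite -[k.+1 in RHS]card_ord -prod_nat_const; apply: eq_bigr => i _.
  by rewrite tight_factor // ffunE.
rewrite (@card_maximum_from_sizes _ _ _ (fun _ : unit => r0) tt).
- by rewrite sum_nat_const card_unit mul1n.
- by case; case.
- move=> _; have /= := @double_sum_slack n k.+1 (fun i => r0 i : nat) (fun=> 0)
    (fun i => etrans (addn0 _) (adj i)).
  by rewrite big1_eq; lia.
- move=> r r_gt0 rM; exists tt.
  have := sum_slack_parity r_gt0 rM; rewrite oddM (negbTE en) => /eqP.
  rewrite sum_nat_eq0 => /forallP sl0.
  apply/ffunP=> i; apply: val_inj => /=.
  apply: (@adjacent_sums_odd_inj _ (fun i => r i : nat) (fun i => r0 i : nat)) => // {}i.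
  have := sl0 i; have := weight_gt0 r_gt0 i; rewrite adj; lia.
- by rewrite wr0 expn_gt0 ffact_gt0; lia.
Qed.

(** One size vector [f i0] for each position [i0] of the slack, all of the same
weight. *)
Lemma card_maximum_odd_odd n k : odd k.+1 -> odd n ->
  #|[set A : {set cell n k.+1} | maximum_placement A]| =
    k.+1 * uphalf n * (n ^_ (uphalf n)) ^ k.+1./2 * (n ^_ n./2) ^ uphalf k.+1.
Proof.
move=> ok on.
(* The parity of the cyclic distance from [i0] to [i]: going around from
   [i0] to some [i < i0] adds the odd length of the cycle. *)
pose b (i0 i : 'I_k.+1) : bool := (i < i0) (+) odd i (+) odd i0.
pose f i0 : {ffun 'I_k.+1 -> 'I_n.+1} := [ffun i => inord (n./2 + b i0 i)].
have fE i0 i : f i0 i = n./2 + b i0 i :> nat.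
  by rewrite ffunE inordK //; case: (b i0 i); lia.
have bE i0 : b i0 i0 = false by rewrite /b ltnn addFb addbb.
have b_pred i0 i : b i0 (ord_pred i) = if i == i0 then false else ~~ b i0 i.
  rewrite /b val_ord_pred -val_eqE /=; have := ltn_ord i; have := ltn_ord i0.
  by case: eqP; case: eqP; lia.
have adj i0 i : f i0 (ord_pred i) + f i0 i + (i == i0) = n.
  rewrite !fE b_pred; case: eqP => [->|_]; first by rewrite bE; lia.
  by case: (b i0 i) => /=; lia.
have fsum i0 : \sum_i f i0 i = (n * k.+1)./2.
  have /= := @double_sum_slack n k.+1 (fun i => f i0 i : nat) (fun i => i == i0) (adj i0).
  have -> : \sum_(i < k.+1) (i == i0) = 1.
    by rewrite (bigD1 i0) //= eqxx big1 // => i /negbTE->.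
  lia.
(* The total [(n * k.+1)./2] is already known, which gives the number of entries
   equal to [uphalf n] without counting them. *)
have card_b i0 : \sum_i b i0 i = k.+1./2.
  have := fsum i0; under eq_bigr do rewrite fE.
  by rewrite big_split sum_nat_const card_ord /=; nia.
have fw i0 : weight (f i0) =
    uphalf n * (n ^_ (uphalf n)) ^ k.+1./2 * (n ^_ n./2) ^ uphalf k.+1.
  have factor i : 'C(n, f i0 i) * (n - f i0 (ord_pred i)) ^_ (f i0 i) =
      (if i == i0 then uphalf n else 1) *
      ((n ^_ uphalf n) ^ b i0 i * (n ^_ n./2) ^ ~~ b i0 i).
    (* At [i0] there are [n./2.+1] free columns for [n./2] rooks, and
       [n./2.+1 ^_ n./2 = (n./2.+1)`!]. *)
    case: eqP => [->|/eqP ne].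
      rewrite !fE b_pred eqxx bE !addn0 expn0 expn1 mul1n.
      have -> : n - n./2 = n./2.+1 by lia.
      have := ffact_fact (leqnSn n./2); rewrite subSnn muln1 => ->.
      by rewrite factS mulnCA bin_ffact uphalf_half on.
    rewrite tight_factor; last by have := adj i0 i; rewrite (negbTE ne) addn0.
    rewrite fE mul1n uphalf_half on addnC.
    by case: (b i0 i); rewrite expn0 expn1 ?muln1 ?mul1n.
  rewrite /weight (eq_bigr _ (fun i _ => factor i)) !big_split /=.
  rewrite -big_mkcond big_pred1_eq -!expn_sum card_b mulnA; congr (_ * _ ^ _).
  have : \sum_i b i0 i + \sum_i ~~ b i0 i = k.+1.
    rewrite -big_split (eq_bigr (fun=> 1)) ?sum1_card ?card_ord // => i _.
    by case: (b i0 i).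
  by rewrite card_b => /(canRL (addKn _)) ->; lia.
rewrite (@card_maximum_from_sizes _ _ _ f ord0).
- by rewrite (eq_bigr _ (fun i _ => fw i)) sum_nat_const card_ord !mulnA.
- move=> i0 i1 E; apply/eqP; have := adj i0 i0; have := adj i1 i0.
  rewrite E eqxx; case: (i0 == i1) => //=; lia.
- exact: fsum.
- move=> r r_gt0 rM.
  have := sum_slack_parity r_gt0 rM; rewrite oddM on ok => /eqP/sum_nat_eq1[i0 [_ s0 s1]].
  exists i0; apply/ffunP=> i; apply: val_inj => /=.
  apply: (@adjacent_sums_odd_inj _ (fun i => r i : nat)
    (fun i => f i0 i : nat)) => // {}i.
  have := adj i0 i; have := weight_gt0 r_gt0 i.
  case: (eqVneq i i0) => [->|ne]; first by have := s0; lia.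
  by have := s1 i ne isT; lia.
- by rewrite fw !muln_gt0 !expn_gt0 !ffact_gt0; lia.
Qed.

Theorem theorem2p10 (n k : nat) (hn : 0 < n) (hk : 0 < k) :
  [/\ ~~ odd k ->
        #|[set A : {set cell n k} | maximum_placement A]| =
          n`! ^ k./2 * \sum_(0 <= j < n.+1) 'C(n, j) ^ k./2,
      odd k -> ~~ odd n ->
        #|[set A : {set cell n k} | maximum_placement A]| = (n ^_ n./2) ^ k
    & odd k -> odd n ->
        #|[set A : {set cell n k} | maximum_placement A]| =
          k * uphalf n * (n ^_ (uphalf n)) ^ k./2 * (n ^_ n./2) ^ uphalf k].
Proof.
case: k hk => // k _; split.
- exact: card_maximum_even.
- exact: card_maximum_odd_even.
- exact: card_maximum_odd_odd.
Qed.
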